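(* Let $p_+,p_-$ be probability densities on $\mathcal{X}\subseteq\mathbb{R}^d$ with $p_->0$ on $\mathcal{X}$, let $\gamma:[0,\infty)\to\mathbb{R}$ be any strictly increasing function, and let $t^*(x)=\gamma\!\left(\frac{p_+(x)}{p_-(x)}\right)$ be such that the standing assumptions on score functions hold for $t^*$. Set $g(s)=\sqrt{s^2+1}-\sqrt{2}$ for $s\ge 0$. Then $$\mathrm{arc}(\mathrm{ROC}(t^* ))-\sqrt{2}=\mathbb{E}_{p_-}\!\left[g\!\left(\frac{p_+(x)}{p_-(x)}\right)\right].$$ Moreover $g$ is convex with $g(1)=0$, so that $\mathrm{arc}(\mathrm{ROC}(t^* ))-\sqrt2$ is the $f$-divergence $\mathrm{D}_g(p_+|p_-)$ between the data distributions, and it does not depend on the choice of $\gamma$.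
   Context: $\mathbb{P}_+$ and $\mathbb{P}_-$ are distributions on $\mathcal{X}\subseteq\mathbb{R}^d$ with densities $p_+$ and $p_-$. For a measurable score function $t:\mathcal{X}\to\mathbb{R}$, $F_+$ and $F_-$ are the CDFs of $t(x^+)$ and $t(x^-)$ with $x^+\sim\mathbb{P}_+$, $x^-\sim\mathbb{P}_-$. Standing assumptions on score functions: $F_+$ and $F_-$ are strictly increasing on the interval of score values and have densities $f_+,f_-$ (with $f_->0$ on that interval; both vanish outside it). With $\tilde F_\pm=1-F_\pm$, the ROC curve $\mathrm{ROC}(t)$ is the graph of $s\mapsto\tilde F_+(\tilde F_-^{-1}(s))$, $s\in[0,1]$, parameterized by $\tau\mapsto(\tilde F_-(\tau),\tilde F_+(\tau))$; its arc length is $$\mathrm{arc}(\mathrm{ROC}(t))=\int_{-\infty}^{\infty}\sqrt{f_+(\tau)^2+f_-(\tau)^2}\,\mathrm{d}\tau .$$ For a convex lower-semicontinuous $g$ with $g(1)=0$, the $f$-divergence is $\mathrm{D}_g(p|q)=\mathbb{E}_q\!\left[g\!\left(\frac{p}{q}\right)\right]$. *)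

(* Defs.v *)
From HB Require Import structures.
From mathcomp Require Import all_boot all_order all_algebra.
From mathcomp Require Import all_classical all_reals all_analysis.

Set Implicit Arguments.
Unset Strict Implicit.
Unset Printing Implicit Defensive.

Import Order.TTheory GRing.Theory Num.Theory.
Import numFieldNormedType.Exports.

Local Open Scope classical_set_scope.
Local Open Scope ring_scope.

(* The points of R^d are the [d.-tuple R], with the product (Borel)
   sigma-algebra. Lebesgue measure on R^d is the iterated product of the
   one-dimensional one; [lebesgue_tuple_box] gives its value on boxes. *)
Section lebesgue_tuple.
Variable R : realType.

Definition cons_tuple n (z : R * n.-tuple R) : n.+1.-tuple R :=
  [tuple of z.1 :: z.2].

Lemma measurable_cons_tuple n : measurable_fun setT (@cons_tuple n).
Proof. exact: measurable_cons. Qed.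

Lemma measurable_cons_tuple_preimage n (A : set (n.+1.-tuple R)) :
  measurable A -> measurable (@cons_tuple n @^-1` A).
Proof.
by move=> mA; rewrite -[X in measurable X]setTI; exact: measurable_cons_tuple.
Qed.

Section cons_measure.
Variables (n : nat) (m : {sigma_finite_measure set (n.-tuple R) -> \bar R}).

Definition cons_measure : set (n.+1.-tuple R) -> \bar R :=
  pushforward (@lebesgue_measure R \x m)%E (@cons_tuple n).

Let cons_measure0 : cons_measure set0 = 0%E.
Proof. by rewrite /cons_measure /pushforward preimage_set0 measure0. Qed.

Let cons_measure_ge0 A : (0 <= cons_measure A)%E.
Proof. by rewrite /cons_measure /pushforward; exact: measure_ge0. Qed.

Let cons_measure_sigma_additive : semi_sigma_additive cons_measure.
Proof.
move=> F mF tF mUF; rewrite /cons_measure /pushforward preimage_bigcup.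
apply: measure_semi_sigma_additive.
- by move=> k; exact: measurable_cons_tuple_preimage.
- apply/trivIsetP => /= i j _ _ ij; rewrite -preimage_setI.
  by move/trivIsetP : tF => /(_ _ _ _ _ ij) ->//; rewrite preimage_set0.
- by rewrite -preimage_bigcup; exact: measurable_cons_tuple_preimage.
Qed.

HB.instance Definition _ := isMeasure.Build _ _ _ cons_measure
  cons_measure0 cons_measure_ge0 cons_measure_sigma_additive.

Let cons_measure_sigma_finite : sigma_finite setT cons_measure.
Proof.
have /sigma_finiteP[F [TF ndF Foo]] := sigma_finiteT (@lebesgue_measure R).
have /sigma_finiteP[G [TG ndG Goo]] := sigma_finiteT m.
exists (fun k => [set v | F k (thead v) /\ G k [tuple of behead v]]).
  apply/esym; rewrite -subTset => v _.
  have [k _ Fk] : (\bigcup_k F k) (thead v) by rewrite -TF.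
  have [l _ Gl] : (\bigcup_k G k) [tuple of behead v] by rewrite -TG.
  exists (maxn k l) => //; split.
  - by move: Fk; exact/subsetPset/ndF/leq_maxl.
  - by move: Gl; exact/subsetPset/ndG/leq_maxr.
move=> k; have [mF Fk] := Foo k; have [mG Gk] := Goo k; split.
  apply: measurableI; rewrite -[X in measurable X]setTI.
  - exact: measurable_tnth.
  - exact: measurable_behead.
rewrite /cons_measure /pushforward (_ : _ @^-1` _ = F k `*` G k); last first.
  by apply/seteqP; split=> -[x v]; rewrite /= theadE (_ : [tuple of _] = v)//;
    apply/val_inj.
by rewrite product_measure1E// lte_mul_pinfty// ge0_fin_numE.
Qed.

HB.instance Definition _ := Measure_isSigmaFinite.Build _ _ _ cons_measure
  cons_measure_sigma_finite.

End cons_measure.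

Fixpoint lebesgue_tuple n : {sigma_finite_measure set (n.-tuple R) -> \bar R} :=
  match n with
  | 0 => [the {sigma_finite_measure set (0.-tuple R) -> \bar R} of
           dirac ([tuple] : 0.-tuple R)]
  | n'.+1 => [the {sigma_finite_measure set (n'.+1.-tuple R) -> \bar R} of
               cons_measure (lebesgue_tuple n')]
  end.

Lemma lebesgue_tuple_box n (A : 'I_n -> set R) :
  (forall i, measurable (A i)) ->
  lebesgue_tuple n [set v | forall i, A i (tnth v i)] =
  (\prod_(i < n) lebesgue_measure (A i : set (measurableTypeR R)))%E.
Proof.
elim: n A => [|n IHn] A mA /=.
  by rewrite big_ord0 diracE mem_set// => -[].
rewrite big_ord_recl -(IHn (fun i => A (lift ord0 i))) => [|i]; last exact: mA.
rewrite -product_measure1E => [||]; last 2 first.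
- exact: mA.
- rewrite [X in measurable X](_ : _ = \bigcap_(i in [set: 'I_n])
      ((fun v : n.-tuple R => tnth v i) @^-1` A (lift ord0 i))); last first.
    by apply/seteqP; split=> v h i //=; exact: h.
  apply: fin_bigcap_measurable => // i _; rewrite -[X in measurable X]setTI.
  by apply: measurable_tnth => //; exact: mA.
rewrite /cons_measure /pushforward; congr (_ _).
apply/seteqP; split => -[x v] /=.
- move=> h; split; first exact: (h ord0).
  by move=> i; have := h (lift ord0 i); rewrite tnthS.
- move=> [hx hv] i; case: (unliftP ord0 i) => [j|] ->.
    by rewrite tnthS; exact: hv.
  by [].
Qed.

End lebesgue_tuple.

Section scores.
Variables (R : realType) (d : nat).
Local Notation Rd := (d.-tuple R).

(* The law P is carried by X and has density p on X with respect to Lebesgue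
   measure. The values of p outside X are irrelevant. *)
Definition has_density (X : set Rd) (P : probability Rd R) (p : Rd -> R) :=
  [/\ measurable_fun X p,
      (forall x, X x -> 0 <= p x) &
      forall A, measurable A ->
        P A = (\int[lebesgue_tuple R d]_(x in A `&` X) (p x)%:E)%E].

Definition score_cdf (X : set Rd) (P : probability Rd R) (t : Rd -> R)
    (tau : R) : \bar R :=
  P (X `&` [set x | t x <= tau]).

Definition cdf_density (F : R -> \bar R) (f : R -> R) :=
  [/\ measurable_fun setT f,
      (forall tau, 0 <= f tau) &
      forall tau,
        F tau = (\int[lebesgue_measure]_(u in `]-oo, tau]) (f u)%:E)%E].

Definition strictly_increasing_on (I : set R) (F : R -> \bar R) :=
  forall x y, I x -> I y -> x < y -> (F x < F y)%E.

(* Standing assumptions on a score function t : X -> R whose values under Pp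
   and Pm have densities fp and fm. The interval I contains the score values;
   strict monotonicity of the CDFs on I then determines it up to endpoints. *)
Definition score_assumptions (X : set Rd) (Pp Pm : probability Rd R)
    (t : Rd -> R) (fp fm : R -> R) :=
  measurable_fun X t /\
  (cdf_density (score_cdf X Pp t) fp /\ cdf_density (score_cdf X Pm t) fm) /\
  exists I : set R,
    [/\ is_interval I,
        t @` X `<=` I,
        strictly_increasing_on I (score_cdf X Pp t),
        strictly_increasing_on I (score_cdf X Pm t) &
        (forall tau, I tau -> 0 < fm tau) /\
        (forall tau, ~ I tau -> fp tau = 0 /\ fm tau = 0)].

End scores.

(* Arc length of the ROC curve tau |-> (1 - F_-(tau), 1 - F_+(tau)) of a score
   function whose CDFs F_+ and F_- have densities fp and fm: the integral of
   the speed of this parametrization. *)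
Definition arc_ROC (R : realType) (fp fm : R -> R) : \bar R :=
  (\int[lebesgue_measure]_tau (Num.sqrt (fp tau ^+ 2 + fm tau ^+ 2))%:E)%E.

(* Convex lower semicontinuous functions g on [0, +oo[ with g 1 = 0; lower
   semicontinuity is that of the extension of g by +oo. *)
Definition divergence_generator (R : realType) (g : R -> R) :=
  [/\ convex_function (`[0, +oo[%classic : set R) g,
      lower_semicontinuous
        (fun s : R => if 0 <= s then (g s)%:E else +oo%E) &
      g 1 = 0].

(* D_g(p|q) = E_q[g(p/q)], where Q is the law on X with density q. *)
Definition f_divergence (R : realType) (d : nat) (g : R -> R)
    (X : set (d.-tuple R)) (Q : probability (d.-tuple R) R)
    (p q : d.-tuple R -> R) : \bar R :=
  (\int[Q]_(x in X) (g (p x / q x))%:E)%E.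

Definition roc_generator (R : realType) (s : R) : R :=
  Num.sqrt (s ^+ 2 + 1) - Num.sqrt 2.

Definition strictly_increasing_nonneg (R : realType) (gamma : R -> R) :=
  forall s s', 0 <= s -> s < s' -> gamma s < gamma s'.

Definition ratio_score (R : realType) (d : nat) (gamma : R -> R)
    (pp pm : d.-tuple R -> R) (x : d.-tuple R) : R :=
  gamma (pp x / pm x).

(* Main.v *)
Require Import Defs.
From HB Require Import structures.
From mathcomp Require Import all_boot all_order all_algebra.
From mathcomp Require Import all_classical all_reals all_analysis.
From mathcomp Require Import measurable_realfun.
From mathcomp Require Import ring.
Import Order.TTheory GRing.Theory Num.Theory.
Import numFieldNormedType.Exports.
Local Open Scope classical_set_scope.
Local Open Scope ring_scope.

(** The likelihood ratio r = p_+/p_- is recovered from the score t = gamma(r)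
  by a measurable left inverse h of gamma. Let nu_+ and nu_- be the laws of t
  under P_+ and P_-; they have densities f_+ and f_-. Since P_+ has density r
  with respect to P_-, the law nu_+ has density h with respect to nu_-, so
  f_+ = h f_- almost everywhere. Therefore sqrt (f_+^2 + f_-^2) is
  sqrt (h^2 + 1) f_-, and its integral is the integral of sqrt (r^2 + 1) with
  respect to P_-. *)

Set Implicit Arguments.
Unset Strict Implicit.

(** * Measures given by densities and measures determined by half-lines *)

Section density_measure.
Context d (T : measurableType d) (R : realType).
Variables (mu : {measure set T -> \bar R}) (f : T -> \bar R).
Hypotheses (mf : measurable_fun setT f) (f0 : forall x, (0 <= f x)%E).

(* The proof arguments let the measure instance be inferred. *)
Definition density_measure (_ : measurable_fun setT f)
  (_ : forall x, (0 <= f x)%E) (A : set T) : \bar R :=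
  (\int[mu]_(x in A) f x)%E.

Local Notation m := (density_measure mf f0).

Let m0 : m set0 = 0%E. Proof. exact: integral_set0. Qed.

Let m_ge0 A : (0 <= m A)%E.
Proof. exact: integral_ge0. Qed.

Let m_sigma_additive : semi_sigma_additive m.
Proof. exact: semi_sigma_additive_nng_induced. Qed.

HB.instance Definition _ := isMeasure.Build _ _ _ m m0 m_ge0 m_sigma_additive.

End density_measure.

(** [p] and the Radon-Nikodym derivative of [nu] have the same integral over every measurable set,
    so they agree almost everywhere; the change of variables known for the derivative then passes to
    [p]. *)
Lemma integral_density d (T : measurableType d) (R : realType)
    (mu : {sigma_finite_measure set T -> \bar R})
    (nu : {finite_measure set T -> \bar R}) (p : T -> \bar R) (D : set T)
    (f : T -> \bar R) :
  measurable_fun setT p ->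
  (forall A, measurable A -> nu A = \int[mu]_(x in A) p x)%E ->
  measurable D -> measurable_fun D f -> (forall x, 0 <= f x)%E ->
  (\int[nu]_(x in D) f x = \int[mu]_(x in D) (f x * p x))%E.
Proof.
move=> mp nuE mD mf f0.
have numu : nu `<< mu.
  apply/null_content_dominatesP => A mA muA0; rewrite nuE//.
  by apply: null_set_integral => //; exact: measurable_funTS.
have mg := measurable_int _ (Radon_Nikodym_SigmaFinite.f_integrable numu).
rewrite -(Radon_Nikodym_SigmaFinite.change_of_variables numu)//.
apply: ae_eq_integral => //.
- by apply: emeasurable_funM => //; exact: measurable_funTS.
- by apply: emeasurable_funM => //; exact: measurable_funTS.
apply: ae_eqe_mul2l.
have : ae_eq mu setT (Radon_Nikodym_SigmaFinite.f nu mu) p.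
  apply: integral_ae_eq => //.
    exact: Radon_Nikodym_SigmaFinite.f_integrable.
  move=> E _ mE; rewrite -nuE//.
  by rewrite -Radon_Nikodym_SigmaFinite.f_integral.
by apply: ae_eq_subset.
Qed.

(** The intervals []a, b]] are stable under intersection and generate the Borel sets. Each is a
    difference of two half-lines of finite measure, so both measures agree on it. *)
Lemma halfline_measure_unique (R : realType)
    (m1 m2 : {measure set (measurableTypeR R) -> \bar R}) :
  (forall x, m1 `]-oo, x] = m2 `]-oo, x])%classic ->
  (forall x, m1 `]-oo, x]%classic < +oo)%E ->
  forall A, measurable A -> m1 A = m2 A.
Proof.
move=> m12 m1oo A mA.
have m1oc (a b : R) : (m1 `]a, b]%classic < +oo)%E.
  apply: le_lt_trans (m1oo b); apply: le_measure => //; rewrite ?inE//.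
  exact: subset_itvr.
refine (@measure_unique _ _ (measurableTypeR R) (@ocitv R)
  (fun n => `](- n%:R), n%:R]%classic) erefl _ _ _ m1 m2 _ _ A mA) => //.
- exact: ocitvI.
- by move=> i; exact: is_ocitv.
- apply/seteqP; split=> // x _; exists (Num.bound `|x|).+1 => //=.
  have : `|x| < (Num.bound `|x|).+1%:R.
    by rewrite (lt_trans (archi_boundP (normr_ge0 x)))// ltr_nat.
  by rewrite ltr_norml in_itv/= => /andP[-> /ltW].
- move=> _ [[a b] _ <-] /=.
  have [ab | ba] := leP a b; last first.
    by rewrite set_itv_ge ?measure0// bnd_simp -leNgt ltW.
  have mD (m : {measure set (measurableTypeR R) -> \bar R}) :
      (m `]-oo, b]%classic < +oo)%E ->
      m `]a, b]%classic = (m `]-oo, b]%classic - m `]-oo, a]%classic)%E.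
    move=> moo; have -> : `]a, b]%classic = `]-oo, b] `\` `]-oo, a].
      by rewrite -[RHS]setCK setCD setCitvl setUC -[LHS]setCK setCitv.
    by rewrite measureD// setIidr//; exact: subset_itvl.
  by rewrite !mD -?m12.
Qed.

(** * A measurable left inverse of [gamma] *)

(** The generalized inverse, sending [u] to the supremum of the [s >= 0] with [gamma s <= u], is
    monotone and hence measurable, even where [gamma] jumps. *)
Lemma strictly_increasing_nonneg_left_inverse (R : realType) (gamma : R -> R) :
  strictly_increasing_nonneg gamma ->
  exists h : R -> R, [/\ measurable_fun setT h, forall u, 0 <= h u &
    forall s, 0 <= s -> h (gamma s) = s].
Proof.
move=> gammaI.
have gamma_le s s' : 0 <= s' -> gamma s <= gamma s' -> s <= s'.
  by move=> s'0; apply: contra_le => s's; exact: gammaI.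
(* The supremum is taken in the extended reals because [S u] may be empty or unbounded; [fine] later
   sends both infinite values to 0. *)
pose S u := [set s%:E | s in [set s | 0 <= s /\ gamma s <= u]].
pose k u : \bar R := ereal_sup (S u).
have k_nd u v : u <= v -> (k u <= k v)%E.
  move=> uv; apply: le_ereal_sup => _ [s [s0 su] <-]; exists s => //.
  by split => //; exact: le_trans uv.
have mk : measurable_fun setT k.
  apply: (measurability _ (ErealGenOInfty.measurableE R)).
  move=> /= _ [_ [a ->]] <-; apply: measurableI => //.
  (* By monotonicity the preimage of an upper ray is upward closed, hence an interval. *)
  apply: is_interval_measurable => s t /=.
  rewrite !in_itv/= !andbT => ks _ u /andP[su _].
  by rewrite in_itv/= andbT (lt_le_trans ks)// k_nd.
have kE s : 0 <= s -> k (gamma s) = s%:E.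
  move=> s0; apply/eqP; rewrite eq_le; apply/andP; split.
    by apply: ge_ereal_sup => _ [s' [s'0 s's] <-]; rewrite lee_fin gamma_le.
  by apply: ereal_sup_ubound; exists s.
exists (fun u => `|fine (k u)|); split => [|u|s s0].
- apply: measurableT_comp => //.
  exact: measurableT_comp.
- exact: normr_ge0.
- by rewrite kE//= ger0_norm.
Qed.

(** * The law of a score function *)

Section score_law.
Context (R : realType) (d : nat).
Local Notation Rd := (d.-tuple R).
Local Notation mu := (@lebesgue_measure R).
Variables (X : set Rd) (P : probability Rd R) (t : Rd -> R) (f : R -> R).
Hypotheses (mX : measurable X) (mt : measurable_fun X t)
  (tf : cdf_density (score_cdf X P t) f).

Let mtX : measurable_fun setT (t \_ X).
Proof. by apply/(measurable_restrictT _ mX). Qed.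

(** The score is measurable only on [X], so it is extended by 0. Restricting [P] to [X] keeps this
    extension from adding mass at 0. *)
Let nu (B : set (measurableTypeR R)) : \bar R :=
  pushforward (mrestr P mX) (t \_ X : Rd -> measurableTypeR R) B.

Let nu0 : nu set0 = 0%E. Proof. exact: measure0. Qed.

Let nu_ge0 B : (0 <= nu B)%E. Proof. exact: measure_ge0. Qed.

Let nu_sigma_additive : semi_sigma_additive nu.
Proof. exact: measure_semi_sigma_additive. Qed.

HB.instance Definition _ := isMeasure.Build _ _ _ nu
  nu0 nu_ge0 nu_sigma_additive.

Let nuE (B : set R) : nu B = P (X `&` t @^-1` B).
Proof.
rewrite /nu /= /pushforward /mrestr; congr (P _).
apply/seteqP; split=> x /=; rewrite /patch.
- by move=> [] /[swap] Xx; rewrite mem_set.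
- by move=> [Xx]; rewrite mem_set.
Qed.

Let nu_fin : fin_num_fun nu.
Proof. by move=> B mB; rewrite nuE fin_num_measure//; exact: mt. Qed.

HB.instance Definition _ := Measure_isFinite.Build _ _ _ nu nu_fin.

(** The CDF hypothesis is this identity for half-lines, and finite half-line masses determine a
    measure. *)
Lemma score_law_density (B : set R) : measurable B ->
  P (X `&` t @^-1` B) = (\int[mu]_(u in B) (f u)%:E)%E.
Proof.
case: tf => mf f0 tfE mB.
have mfE : measurable_fun [set: measurableTypeR R] (EFin \o f).
  exact/measurable_EFinP.
have fE0 u : (0 <= (EFin \o f) u)%E by rewrite lee_fin.
rewrite -nuE.
refine (halfline_measure_unique (m1 := nu)
  (m2 := density_measure mu mfE fE0) _ _ mB) => x.
  by apply: etrans (nuE _) _; rewrite -[RHS]tfE; congr (P (_ `&` _)).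
rewrite [X in (X < _)%E](nuE _) (le_lt_trans (probability_le1 _ _)) ?ltry//.
exact: mt.
Qed.

(** Both sides equal the integral of [phi] over [B] for the law [nu]: one by transport along [t],
    the other by the density [f]. *)
Lemma integral_score (phi : R -> R) (B : set R) :
  measurable_fun setT phi -> (forall u, 0 <= phi u) -> measurable B ->
  (\int[P]_(x in X `&` t @^-1` B) (phi (t x))%:E =
   \int[mu]_(u in B) (phi u * f u)%:E)%E.
Proof.
case: tf => mf f0 _ mphi phi0 mB.
under [RHS]eq_integral do rewrite EFinM.
rewrite -(@integral_density _ _ _ mu nu (EFin \o f))//.
- have mD : measurable ((t \_ X) @^-1` B).
    by rewrite -[X in measurable X]setTI; exact: mtX.
  have mphit : measurable_fun ((t \_ X) @^-1` B)
      (fun x => (phi ((t \_ X) x))%:E).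
    apply/measurable_EFinP; apply: measurable_funTS.
    exact: measurableT_comp.
  transitivity (\int[mrestr P mX]_(x in (t \_ X) @^-1` B)
      (phi ((t \_ X) x))%:E)%E; last first.
    apply/esym; refine (@ge0_integral_pushforward _ _ Rd (measurableTypeR R) R
      (t \_ X) mtX (mrestr P mX) B (EFin \o phi) mB _ _).
      exact/measurable_EFinP/measurable_funTS.
    by move=> u _; rewrite lee_fin.
  (* If 0 lies in [B], the preimage also contains the complement of [X], which is null for the
     restricted measure. *)
  rewrite [RHS](@ge0_negligible_integral _ _ _ _ _ (~` X))//; last 3 first.
  - exact: measurableC.
  - by move=> x _; rewrite lee_fin.
  - by rewrite /= /mrestr setICl measure0.
  have -> : (t \_ X) @^-1` B `\` ~` X = X `&` t @^-1` B.
    rewrite setDE setCK; apply/seteqP; split=> x /=; rewrite /patch.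
    + by move=> [] /[swap] Xx; rewrite mem_set.
    + by move=> [Xx]; rewrite mem_set.
  transitivity (\int[mrestr P mX]_(x in X `&` t @^-1` B) (phi (t x))%:E)%E.
    apply: eq_measure_integral => A mA AX /=.
    by rewrite /mrestr setIidl// => x /AX[].
  by apply: eq_integral => x; rewrite inE patchE => -[Xx _]; rewrite mem_set.
- exact/measurable_EFinP.
- by move=> A mA; rewrite [LHS]nuE; exact: score_law_density.
- exact/measurable_EFinP/measurable_funTS.
Qed.

End score_law.

(** * The likelihood ratio and the arc length *)

Lemma has_density_support (R : realType) (d : nat) (X : set (d.-tuple R))
    (P : probability (d.-tuple R) R) (p : d.-tuple R -> R) :
  measurable X -> has_density X P p -> P X = 1%E.
Proof.
move=> mX [_ _ PE].
by rewrite -(probability_setT P) (PE X)// (PE setT)// setTI setIid.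
Qed.

Lemma integral_likelihood_ratio (R : realType) (d : nat) (X : set (d.-tuple R))
    (P Q : probability (d.-tuple R) R) (p q : d.-tuple R -> R)
    (A : set (d.-tuple R)) :
  measurable X -> has_density X P p -> has_density X Q q ->
  (forall x, X x -> 0 < q x) -> measurable_fun X (fun x => p x / q x) ->
  measurable A -> A `<=` X ->
  (\int[Q]_(x in A) (p x / q x)%:E = P A)%E.
Proof.
move=> mX [mp p0 PE] [mq q0 QE] q_gt0 mr mA AX.
(* Extension by 0 makes the ratio measurable and nonnegative on the whole space, as
   [integral_density] is applied to a function nonnegative everywhere. *)
pose r := (fun x => p x / q x) \_ X.
have mr' : measurable_fun setT r by apply/(measurable_restrictT _ mX).
have r0 x : 0 <= r x.
  rewrite /r patchE; case: ifPn => // /set_mem Xx.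
  by rewrite divr_ge0 ?p0 ?q0.
transitivity (\int[Q]_(x in A) (r x)%:E)%E.
  by apply: eq_integral => x /set_mem /AX Xx; rewrite /r patchE mem_set.
rewrite (@integral_density _ _ _ (lebesgue_tuple R d) Q (EFin \o (q \_ X)))//.
- rewrite PE// setIidl//; apply: eq_integral => x /set_mem /AX Xx /=.
  by rewrite /r !patchE mem_set// -EFinM divfK// gt_eqF// q_gt0.
- by apply/measurable_EFinP/(measurable_restrictT _ mX).
- move=> B mB; apply: etrans (QE B mB) _; rewrite integral_mkcondr.
  by apply: eq_integral => x _ /=; rewrite !patchE; case: ifP.
- exact/measurable_EFinP/measurable_funTS.
Qed.

Section arc_length.
Context (R : realType) (d : nat).
Variables (X : set (d.-tuple R)) (Pp Pm : probability (d.-tuple R) R)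
  (pp pm : d.-tuple R -> R).
Hypotheses (mX : measurable X) (hPp : has_density X Pp pp)
  (hPm : has_density X Pm pm) (pm_gt0 : forall x, X x -> 0 < pm x).

Lemma ratio_ge0 x : X x -> 0 <= pp x / pm x.
Proof.
move=> Xx; have [_ pp0 _] := hPp.
by rewrite divr_ge0 ?pp0// ltW// pm_gt0.
Qed.

Lemma measurable_sqrt : measurable_fun setT (@Num.sqrt R).
Proof. exact: (continuous_measurable_fun (@sqrt_continuous R)). Qed.

Lemma measurable_sqrt_sqr_add1 :
  measurable_fun setT (fun s : R => Num.sqrt (s ^+ 2 + 1)).
Proof.
apply: measurableT_comp; first exact: measurable_sqrt.
by apply: measurable_funD => //; exact: measurable_funX.
Qed.

Variables (gamma fp fm : R -> R).
Hypotheses (hgamma : strictly_increasing_nonneg gamma)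
  (hscore : score_assumptions X Pp Pm (ratio_score gamma pp pm) fp fm).

(** On [X] the ratio is the left inverse of [gamma] composed with the score, and both are
    measurable. *)
Lemma measurable_ratio : measurable_fun X (fun x => pp x / pm x).
Proof.
have [h [mh _ hK]] := strictly_increasing_nonneg_left_inverse hgamma.
have [mt _] := hscore.
apply: (eq_measurable_fun (h \o ratio_score gamma pp pm)).
  by move=> x /set_mem Xx /=; rewrite /ratio_score hK// ratio_ge0.
exact: measurableT_comp.
Qed.

Lemma arc_ROCE : (arc_ROC fp fm =
  \int[Pm]_(x in X) (Num.sqrt ((pp x / pm x) ^+ 2 + 1))%:E)%E.
Proof.
have [h [mh h0 hK]] := strictly_increasing_nonneg_left_inverse hgamma.
have [mt [[tfp tfm] _]] := hscore.
have [mfp fp0 _] := tfp; have [mfm fm0 _] := tfm.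
set t := ratio_score gamma pp pm in mt tfp tfm.
have htE x : X x -> h (t x) = pp x / pm x.
  by move=> Xx; rewrite /t /ratio_score hK// ratio_ge0.
(* Over any Borel set [B] both functions integrate to the [Pp]-probability that the score lies in
   [B]; for the second, the integral is pulled back to [X], where [h (t x)] is the likelihood
   ratio. *)
have fpE : ae_eq lebesgue_measure setT (EFin \o fp) (fun u => (h u * fm u)%:E).
  apply: integral_ae_eq => //.
  - apply/integrableP; split; first exact/measurable_EFinP.
    under eq_integral do rewrite /= ger0_norm//.
    rewrite -(score_law_density mX mt tfp)//.
    rewrite (le_lt_trans (probability_le1 _ _)) ?ltry//.
    exact: mt.
  - exact/measurable_EFinP/measurable_funM.
  - move=> B _ mB.
    have mtB : measurable (X `&` t @^-1` B) by exact: mt.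
    rewrite -(score_law_density mX mt tfp)//.
    rewrite -(integral_score mX mt tfm)//.
    rewrite -(integral_likelihood_ratio mX hPp hPm pm_gt0 measurable_ratio mtB).
      by apply: eq_integral => x /set_mem[Xx _]; rewrite htE.
    by move=> x [].
transitivity (\int[lebesgue_measure]_u (Num.sqrt (h u ^+ 2 + 1) * fm u)%:E)%E.
  apply: ge0_ae_eq_integral => //.
  - apply/measurable_EFinP; apply: measurableT_comp.
      exact: measurable_sqrt.
    by apply: measurable_funD; exact: measurable_funX.
  - apply/measurable_EFinP; apply: measurable_funM => //.
    exact: (measurableT_comp measurable_sqrt_sqr_add1 mh).
  - by move=> u _; rewrite lee_fin mulr_ge0.
  apply: filterS fpE => u /= /(_ Logic.I) [fpE] _; congr EFin.
  (* As [fm u >= 0], it can be moved under the root, which turns the sum of squares into a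
     product. *)
  have -> : fm u = Num.sqrt (fm u ^+ 2) by rewrite sqrtr_sqr ger0_norm.
  rewrite -sqrtrM ?addr_ge0 ?sqr_ge0// sqr_sqrtr ?sqr_ge0// fpE.
  by rewrite mulrDl mul1r exprMn.
rewrite -(integral_score mX mt tfm
  (phi := fun u => Num.sqrt (h u ^+ 2 + 1)))//; last first.
  exact: (measurableT_comp measurable_sqrt_sqr_add1 mh).
rewrite preimage_setT setIT.
by apply: eq_integral => x /set_mem Xx; rewrite htE.
Qed.

(** For [r >= 0] the root of [r ^+ 2 + 1] is at most [r + 1], and the ratio has [Pm]-integral
    [Pp X], which is at most 1. *)
Lemma integrable_sqrt_ratio :
  Pm.-integrable X (fun x => (Num.sqrt ((pp x / pm x) ^+ 2 + 1))%:E).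
Proof.
have mr := measurable_ratio.
have ir : Pm.-integrable X (fun x => (pp x / pm x)%:E).
  apply/integrableP; split; first exact/measurable_EFinP.
  under eq_integral => x /set_mem Xx do rewrite /= ger0_norm ?ratio_ge0//.
  rewrite (integral_likelihood_ratio mX hPp hPm)//.
  by rewrite (le_lt_trans (probability_le1 _ _)) ?ltry.
have i1 : Pm.-integrable X (fun x => (pp x / pm x + 1)%:E).
  under eq_fun do rewrite EFinD.
  apply: integrableD => //.
  exact: finite_measure_integrable_cst.
apply: le_integrable i1 => //.
  apply/measurable_EFinP.
  exact: (measurableT_comp measurable_sqrt_sqr_add1 mr).
move=> x Xx /=; have r0 := ratio_ge0 Xx.
rewrite lee_fin !ger0_norm ?addr_ge0 ?sqrtr_ge0//.
rewrite -[leRHS]ger0_norm ?addr_ge0// -sqrtr_sqr ler_wsqrtr//.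
by rewrite sqrrD expr1n mulr1 lerD2r lerDl mulrn_wge0.
Qed.

End arc_length.

(** * Convexity and lower semicontinuity of the generator *)

(** This is the triangle inequality for the Euclidean norm of the vectors [(x, 1)] and [(y, 1)]. *)
Lemma sqrt_sqr_add1_convex (R : realType) (p q x y : R) :
  0 <= p -> 0 <= q -> p + q = 1 ->
  Num.sqrt ((p * x + q * y) ^+ 2 + 1) <=
  p * Num.sqrt (x ^+ 2 + 1) + q * Num.sqrt (y ^+ 2 + 1).
Proof.
move=> p0 q0 pq.
set a := Num.sqrt (x ^+ 2 + 1); set b := Num.sqrt (y ^+ 2 + 1).
have a2 : a ^+ 2 = x ^+ 2 + 1 by rewrite sqr_sqrtr// addr_ge0 ?sqr_ge0.
have b2 : b ^+ 2 = y ^+ 2 + 1 by rewrite sqr_sqrtr// addr_ge0 ?sqr_ge0.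
have a0 : 0 <= a by exact: sqrtr_ge0.
have b0 : 0 <= b by exact: sqrtr_ge0.
(* Cauchy-Schwarz: the squares of the two sides differ by [(x - y) ^+ 2]. *)
have ab : x * y + 1 <= a * b.
  apply: (le_trans (ler_norm _)); rewrite -[leRHS]ger0_norm ?mulr_ge0//.
  rewrite -ler_sqr ?nnegrE// !real_normK ?num_real// exprMn a2 b2 -subr_ge0.
  by have := sqr_ge0 (x - y); congr (0 <= _); ring.
rewrite -[leRHS]ger0_norm ?addr_ge0 ?mulr_ge0// -sqrtr_sqr ler_wsqrtr//.
(* Writing 1 as [(p + q) ^+ 2] leaves only the cross term [p * q * 2 * (a * b - (x * y + 1))] in the
   difference of squares. *)
have pq2 : p ^+ 2 + q ^+ 2 + p * q * 2 = 1.
  by rewrite -(expr1n R 2) -[in RHS]pq; ring.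
rewrite -[X in _ + X <= _]pq2 -subr_ge0.
have : 0 <= p * q * 2 * (a * b - (x * y + 1)) by rewrite !mulr_ge0// subr_ge0.
congr (0 <= _).
have -> : (p * a + q * b) ^+ 2 =
    p ^+ 2 * a ^+ 2 + q ^+ 2 * b ^+ 2 + p * q * 2 * (a * b) by ring.
by rewrite a2 b2; ring.
Qed.

Lemma roc_generator_divergence (R : realType) :
  divergence_generator (@roc_generator R).
Proof.
split.
- move=> t x y _ _; rewrite !convRE /unstable.onem /roc_generator.
  set p := t%:inum; set q := 1 - p.
  have pq : p + q = 1 by rewrite /q addrC subrK.
  have p0 : 0 <= p by rewrite /p.
  have q0 : 0 <= q by rewrite subr_ge0 /p.
  apply: (@le_trans _ _ (p * Num.sqrt (x ^+ 2 + 1)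
      + q * Num.sqrt (y ^+ 2 + 1) - Num.sqrt 2)).
    by rewrite lerD2r sqrt_sqr_add1_convex.
  by rewrite !mulrBr addrACA -opprD -mulrDl pq mul1r.
- move=> x a.
  (* The formula is continuous on the whole line, so near a point [x >= 0] it stays above [a], while
     negative neighbours have value [+oo]. *)
  have cg : continuous (@roc_generator R).
    move=> y; apply: cvgB; last exact: cvg_cst.
    apply: (continuous_comp (f := fun s : R => s ^+ 2 + 1));
      last exact: sqrt_continuous.
    by apply: cvgD; [exact: exprn_continuous|exact: cvg_cst].
  case: ifPn => [x0 ag|]; last rewrite -ltNge => x0 _.
  + exists [set y | a < roc_generator y].
      exact: (cvgr_gt _ (cg x)).
    by move=> y /= ay; case: ifP => // _; rewrite ltry.
  + exists [set y | y < 0]; first exact: lt_nbhsl.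
    by move=> y /= y0; rewrite leNgt y0 ltry.
- by rewrite /roc_generator expr1n subrr.
Qed.

Unset Implicit Arguments.
Set Strict Implicit.

Theorem mainTheorem1 (R : realType) (d : nat) (X : set (d.-tuple R))
    (Pp Pm : probability (d.-tuple R) R) (pp pm : d.-tuple R -> R)
    (gamma : R -> R) (fp fm : R -> R)
    (mX : measurable X)
    (hPp : has_density X Pp pp)
    (hPm : has_density X Pm pm)
    (pm_gt0 : forall x, X x -> 0 < pm x)
    (hgamma : strictly_increasing_nonneg gamma)
    (hscore : score_assumptions X Pp Pm (ratio_score gamma pp pm) fp fm) :
  (arc_ROC fp fm - (Num.sqrt 2)%:E
     = \int[Pm]_(x in X) (roc_generator (pp x / pm x))%:E)%E
  /\ divergence_generator (@roc_generator R)
  /\ (arc_ROC fp fm - (Num.sqrt 2)%:E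
        = f_divergence (@roc_generator R) X Pm pp pm)%E
  /\ (forall (gamma' fp' fm' : R -> R),
        strictly_increasing_nonneg gamma' ->
        score_assumptions X Pp Pm (ratio_score gamma' pp pm) fp' fm' ->
        arc_ROC fp' fm' = arc_ROC fp fm).
Proof.
(* Kept general in [gamma], [fp] and [fm]: the integral it yields mentions none of them, which gives
   the independence of [gamma]. *)
have arcE := arc_ROCE mX hPp hPm pm_gt0.
suff main : (arc_ROC fp fm - (Num.sqrt 2)%:E
    = \int[Pm]_(x in X) (roc_generator (pp x / pm x))%:E)%E.
  split=> //; split; first exact: roc_generator_divergence.
  split=> // gamma' fp' fm' g' s'.
  by rewrite (arcE _ _ _ g' s') (arcE _ _ _ hgamma hscore).
rewrite (arcE _ _ _ hgamma hscore) /roc_generator.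
under [RHS]eq_integral do rewrite EFinB.
rewrite integralB_EFin//; last 2 first.
- exact: (integrable_sqrt_ratio mX hPp hPm pm_gt0 hgamma hscore).
- exact: finite_measure_integrable_cst.
(* The constant integrates to exactly [Num.sqrt 2] because [Pm X] is 1. *)
by rewrite integral_cst// [X in (_ * X)%E](has_density_support mX hPm) mule1.
Qed.
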